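(* Let $F$ and $G$ be locally finite pointed graphs and let $H$ be a (non-pointed) graph. Suppose that $G$ is connected and that for every connected, finite, pointed subgraph $\hat{G}$ of $G$ we have $F \xrightarrow{poi} (\hat{G},H)$. Then $F \xrightarrow{poi} (G,H)$.
   Context: All graphs are simple, have no isolated vertices, and may be infinite (possibly uncountable). A graph is locally finite if every vertex has finite degree. A pointed graph is a triple $G=(V,E,* )$ where $(V,E)$ is a graph and $*=*_G\in V$ is a specified vertex, called the basepoint. A pointed subgraph of a pointed graph $G$ is a subgraph $H$ (with $V(H)\subseteq V(G)$, $E(H)\subseteq E(G)$) that contains $*_G$ and has basepoint $*_H=*_G$. A pointed graph is locally finite, connected, finite, etc. if its underlying graph is. For pointed graphs $F,G$ and a non-pointed graph $H$, we write $F \xrightarrow{poi} (G,H)$ if for every coloring of the edges of $F$ with the colors red and blue, either there is a pointed subgraph of $F$, all of whose edges are red, that is isomorphic to $G$ by an isomorphism mapping basepoint to basepoint, or the underlying graph of $F$ contains a subgraph isomorphic to $H$ all of whose edges are blue. *)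

(* Defs.v *)
From mathcomp Require Import all_boot.
From mathcomp Require Import boolp classical_sets functions cardinality.
From Stdlib Require Import Relation_Operators.

Set Implicit Arguments.
Unset Strict Implicit.
Unset Printing Implicit Defensive.

Local Open Scope classical_set_scope.

Record graph := Graph {
  vertex :> Type;
  adj : vertex -> vertex -> Prop;
  adj_sym : forall x y, adj x y -> adj y x;
  adj_irrefl : forall x, ~ adj x x;
  adj_noiso : forall x, exists y, adj x y }.

Record pointed_graph := PointedGraph {
  pgraph :> graph;
  basept : pgraph }.

(* A subgraph is itself a graph, so it has no isolated vertices either; it
   need not be induced. *)
Record subgraph (G : graph) := Subgraph {
  sverts : set G;
  sadj : G -> G -> Prop;
  sadj_adj : forall x y, sadj x y -> adj x y;
  sadj_verts : forall x y, sadj x y -> sverts x /\ sverts y;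
  sadj_sym : forall x y, sadj x y -> sadj y x;
  sadj_noiso : forall x, sverts x -> exists y, sadj x y }.

Section GraphOfSubgraph.
Context {G : graph} (S : subgraph G).

Definition sub_vertex : Type := sverts S.

Definition sub_adj (x y : sub_vertex) : Prop := sadj S (val x) (val y).

Lemma sub_adj_sym x y : sub_adj x y -> sub_adj y x.
Proof. exact: sadj_sym. Qed.

Lemma sub_adj_irrefl x : ~ sub_adj x x.
Proof. by move=> /sadj_adj /adj_irrefl. Qed.

Lemma sub_adj_noiso x : exists y, sub_adj x y.
Proof.
have [y xy] := sadj_noiso (set_mem (valP x)).
by exists (SigSub (mem_set (sadj_verts xy).2)).
Qed.

Definition graph_of_subgraph : graph :=
  Graph sub_adj_sym sub_adj_irrefl sub_adj_noiso.

End GraphOfSubgraph.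

Coercion graph_of_subgraph : subgraph >-> graph.

Record pointed_subgraph (G : pointed_graph) := PointedSubgraph {
  psubgraph :> subgraph G;
  sverts_basept : sverts psubgraph (basept G) }.

Definition pointed_graph_of_subgraph (G : pointed_graph)
    (S : pointed_subgraph G) : pointed_graph :=
  @PointedGraph (psubgraph S) (SigSub (mem_set (sverts_basept S))).

Coercion pointed_graph_of_subgraph : pointed_subgraph >-> pointed_graph.

Definition locally_finite (G : graph) : Prop :=
  forall x : G, finite_set [set y : G | adj x y].

Definition finite_graph (G : graph) : Prop := finite_set [set: G].

Definition connected (G : graph) : Prop :=
  forall x y : G, clos_refl_trans G (@adj G) x y.

Definition is_isomorphism (G H : graph) (f : G -> H) : Prop :=
  bijective f /\ forall x y : G, adj x y <-> adj (f x) (f y).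

Definition isomorphic (G H : graph) : Prop :=
  exists f : G -> H, is_isomorphism f.

Definition pointed_isomorphic (G H : pointed_graph) : Prop :=
  exists f : G -> H, is_isomorphism f /\ f (basept G) = basept H.

Inductive color := red | blue.

(* Edges are unordered pairs, hence the symmetry; the values on non-adjacent
   pairs are irrelevant. *)
Definition edge_coloring (F : graph) (c : F -> F -> color) : Prop :=
  forall x y : F, c x y = c y x.

Definition monochromatic (F : graph) (c : F -> F -> color) (k : color)
    (S : subgraph F) : Prop :=
  forall x y : F, sadj S x y -> c x y = k.

Definition arrow_poi (F G : pointed_graph) (H : graph) : Prop :=
  forall c : F -> F -> color, edge_coloring c ->
    (exists S : pointed_subgraph F,
        monochromatic c red S /\ pointed_isomorphic S G) \/
    (exists S : subgraph F, monochromatic c blue S /\ isomorphic S H).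

(* Main.v *)
From mathcomp Require Import all_boot finmap.
From mathcomp Require Import boolp classical_sets functions cardinality filter.
From Stdlib Require Import Relation_Operators.
Require Import Defs.

(** If there is no blue copy of [H], then for every [n] the ball [B_n] of
radius [n] around the basepoint of [G], which is finite since [G] is locally
finite, embeds in red by some [f_n : B_n -> F]. As [f_n] preserves the
basepoint and adjacency, [f_n x] stays in the finite ball of [F] whose radius
is the distance of [x] to the basepoint, so along an ultrafilter on [nat]
containing the tails the sequence [f_n x] is constant, of value [f x] say.
Any two of these limit values are attained simultaneously by a single [f_n]
with [n] arbitrarily large, so [f] is itself a red embedding of [G]. *)

Set Implicit Arguments.
Unset Strict Implicit.
Unset Printing Implicit Defensive.

Local Open Scope classical_set_scope.

(** If no fibre over a point of [A] were in [U], the complements of these finitely many fibres would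
    be, and their intersection misses the preimage of [A]. *)
Lemma ultrafilter_finite_range (T I : Type) (U : set_system T) (g : T -> I)
    (A : set I) :
  UltraFilter U -> finite_set A -> U (g @^-1` A) ->
  exists y, U (g @^-1` [set y]).
Proof.
(* Gives [I] a choice structure, so that [A] can be listed as a finite set [D]. *)
elim/Pchoice: I => I in g A *.
move=> UU /finite_fsetP[D ->] UD; apply: contrapT => /forallNP nU.
have UC : U (\bigcap_(i in [set` D]) ~` (g @^-1` [set i])).
  apply: filter_bigI => i _.
  by have [/nU|] := in_ultra_setVsetC (g @^-1` [set i]) UU.
have [t [tD tC]] := filter_ex (filterI UD UC).
exact: (tC (g t) tD).
Qed.

Section Balls.
Variables (G : graph) (v : G).

Fixpoint gball (n : nat) : set G :=
  if n is m.+1 then gball m `|` \bigcup_(x in gball m) [set y | adj x y]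
  else [set v].

Lemma gballS n x : gball n x -> gball n.+1 x.
Proof. by left. Qed.

Lemma gball_adj n x y : gball n x -> adj x y -> gball n.+1 y.
Proof. by move=> nx xy; right; exists x. Qed.

Lemma gball_le m n x : (m <= n)%N -> gball m x -> gball n x.
Proof.
move=> /subnK <-; elim: (n - m)%N => [//|k IH] /IH.
exact: gballS.
Qed.

Lemma gball_center n : gball n v.
Proof. exact: (@gball_le 0). Qed.

Lemma gball_finite n : locally_finite G -> finite_set (gball n).
Proof.
move=> lfG; elim: n => [|n IH] /=; first exact: finite_set1.
by rewrite finite_setU; split=> //; apply: bigcup_finite.
Qed.

Lemma gball_cover x : connected G -> exists n, gball n x.
Proof.
move=> /(_ v x) vx; have : exists n, gball n v by exists 0%N.
elim: vx => [y z yz [n ny]|//|y z w _ IHy _ IHz /IHy/IHz //].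
by exists n.+1; apply: gball_adj yz.
Qed.

Section BallGraph.
Variable n : nat.

Let ballE (x y : G) := [/\ gball n.+1 x, gball n.+1 y & adj x y].

Lemma gball_noiso x : gball n.+1 x -> exists y, ballE x y.
Proof.
case=> [nx|[y ny yx]].
  have [y xy] := adj_noiso x.
  by exists y; split=> //; [apply: gballS|apply: gball_adj xy].
exists y; split; [exact: gball_adj yx|exact: gballS|exact: adj_sym].
Qed.

(* The radius is [n.+1], since the ball of radius 0 is an isolated vertex. *)
Definition ball_subgraph : subgraph G.
Proof.
apply: (@Subgraph G (gball n.+1) ballE) gball_noiso.
- by move=> x y [].
- by move=> x y [].
- by move=> x y [? ? /adj_sym].
Defined.

Lemma ball_subgraph_conn : connected ball_subgraph.
Proof.
pose c : ball_subgraph := SigSub (mem_set (gball_center n.+1)).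
pose walk := clos_refl_trans _ (@adj ball_subgraph).
(* Induction on the distance to the centre: the bound on [k] keeps the predecessor of [x] inside the
   ball. Both directions are carried along because [clos_refl_trans] does not provide symmetry. *)
have reach k (x : ball_subgraph) :
    gball k (val x) -> (k <= n.+1)%N -> walk c x /\ walk x c.
  elim: k x => [|k IH] x /=.
    by move=> xv _; have -> : x = c; [exact: val_inj|split; apply: rt_refl].
  move=> [kx kn|[y ky yx] kn]; first exact: IH kx (ltnW kn).
  pose y' : ball_subgraph :=
    SigSub (mem_set (gball_le (ltnW kn) ky)).
  have y'x : @adj ball_subgraph y' x.
    by split=> //; [exact: (set_mem (valP y'))|exact: (set_mem (valP x))].
  have [cy yc] := IH y' ky (ltnW kn).
  split; first by apply: rt_trans cy _; apply: rt_step.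
  by apply: rt_trans yc; apply: rt_step; apply: adj_sym.
move=> x y.
have [_ xc] := reach _ x (set_mem (valP x)) (leqnn _).
have [cy _] := reach _ y (set_mem (valP y)) (leqnn _).
exact: rt_trans xc cy.
Qed.

Lemma ball_subgraph_finite : locally_finite G -> finite_graph ball_subgraph.
Proof.
move=> lfG; rewrite /finite_graph (eq_finite_set (card_setT _)).
exact: gball_finite.
Qed.

End BallGraph.
End Balls.

Definition ball_pointed_subgraph (G : pointed_graph) (n : nat) :
    pointed_subgraph G :=
  @PointedSubgraph G (ball_subgraph (basept G) n)
    (gball_center (basept G) n.+1).

Section RedEmbeddings.
Variables (F G : pointed_graph) (c : F -> F -> color).

(** Taking [f] total makes maps for different balls comparable pointwise. Non-adjacency need not be
    preserved, as subgraphs need not be induced. *)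
Definition red_embedding_on (A : set G) (f : G -> F) : Prop :=
  [/\ f (basept G) = basept F,
      forall x y, A x -> A y -> f x = f y -> x = y &
      forall x y, A x -> A y -> adj x y ->
        adj (f x) (f y) /\ c (f x) (f y) = red].

Lemma red_copy_embedding (n : nat) (S : pointed_subgraph F) :
  monochromatic c red S ->
  pointed_isomorphic S (ball_pointed_subgraph G n) ->
  exists f, red_embedding_on (gball (basept G) n.+1) f.
Proof.
move=> Sred [phi [[[psi phiK psiK] phi_adj] phi0]].
pose B := ball_pointed_subgraph G n.
pose f (x : G) : F :=
  (* The value outside the ball is arbitrary. *)
  if pselect (gball (basept G) n.+1 x) is left Bx
  then val (psi (SigSub (mem_set Bx))) else basept F.
have fE (x : B) : f (val x) = val (psi x).
  rewrite /f; case: pselect => [Bx|[]]; last exact: (set_mem (valP x)).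
  by congr (val (psi _)); apply: val_inj.
have lift x : gball (basept G) n.+1 x -> exists x' : B, val x' = x.
  by move=> Bx; exists (SigSub (mem_set Bx)).
exists f; split.
- rewrite -[basept G]/(val (basept B)) fE.
  by rewrite -phi0 phiK.
- move=> _ _ /lift[x <-] /lift[y <-].
  by rewrite !fE => /val_inj /(can_inj psiK) ->.
- move=> _ _ /lift[x <-] /lift[y <-] xy; rewrite !fE.
  have Bxy : @adj B x y.
    by split=> //; [exact: (set_mem (valP x))|exact: (set_mem (valP y))].
  have Sxy : @adj S (psi x) (psi y) by apply/phi_adj; rewrite !psiK.
  by split; [apply: sadj_adj Sxy|apply: Sred Sxy].
Qed.

Lemma red_embedding_copy (f : G -> F) : red_embedding_on [set: G] f ->
  exists S : pointed_subgraph F,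
    monochromatic c red S /\ pointed_isomorphic S G.
Proof.
move=> [f0 f_inj f_adj].
(* Only images of edges of [G] are kept: other edges of [F] within the range of [f] may be blue and
   would spoil the isomorphism. *)
pose E u v := exists x y, [/\ adj x y, u = f x & v = f y].
have EF u v : E u v -> adj u v.
  by move=> [x [y [xy -> ->]]]; have [] := f_adj x y I I xy.
have Everts u v : E u v -> range f u /\ range f v.
  by move=> [x [y [_ -> ->]]]; split; [exists x|exists y].
have Esym u v : E u v -> E v u.
  by move=> [x [y [xy -> ->]]]; exists y, x; split=> //; apply: adj_sym.
have Enoiso u : range f u -> exists v, E u v.
  move=> [x _ <-]; have [y xy] := adj_noiso x.
  by exists (f y), x, y.
pose S := @PointedSubgraph F (Subgraph EF Everts Esym Enoiso)
  (ex_intro2 _ _ (basept G) I f0).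
exists S; split.
  by move=> _ _ [x [y [xy -> ->]]]; have [] := f_adj x y I I xy.
(* The isomorphism must go from [S] to [G], so it is the inverse of [f], obtained by choice. *)
have preim (u : S) : {x : G | f x = val u}.
  by apply: cid; have [x _ <-] := set_mem (valP u); exists x.
pose g (u : S) := sval (preim u).
have gE (u : S) : f (g u) = val u by rewrite /g; case: (preim u).
have gf x (u : S) : val u = f x -> g u = x.
  by move=> ux; apply: f_inj => //; rewrite gE.
exists g; split; last exact: gf.
split=> [|u v].
  exists (fun x => SigSub (mem_set (ex_intro2 _ _ x I (erefl (f x))))).
    by move=> u; apply: val_inj; rewrite /= gE.
  by move=> x; apply: gf.
split=> [[x [y [xy ux vy]]]|xy]; first by rewrite (gf x) ?(gf y).
by exists (g u), (g v); rewrite !gE.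
Qed.

(** Images of paths from the basepoint are walks from the basepoint. The bound [k] is independent of
    [n], which confines all late values at [x] to one finite ball. *)
Lemma red_embedding_ball (k n : nat) (f : G -> F) (x : G) : (k <= n)%N ->
  red_embedding_on (gball (basept G) n) f ->
  gball (basept G) k x -> gball (basept F) k (f x).
Proof.
move=> + [f0 _ f_adj]; elim: k x => [|k IH] x kn /= => [->//|].
move=> [kx|[y ky yx]]; first by left; apply: IH (ltnW kn) kx.
right; exists (f y); first exact: IH (ltnW kn) ky.
have ny := gball_le (ltnW kn) ky.
by have [] := f_adj y x ny (gball_le kn (gball_adj ky yx)) yx.
Qed.

Lemma red_embedding_limit : locally_finite F -> connected G ->
  (forall n, exists f, red_embedding_on (gball (basept G) n.+1) f) ->
  exists f, red_embedding_on [set: G] f.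
Proof.
move=> lfF Gconn /choice[f_ f_emb].
have [U [UU Utail]] := ultraFilterLemma eventually_filter.
have Uball x : U [set n | gball (basept G) n.+1 x].
  have [k kx] := gball_cover (basept G) x Gconn.
  by apply: Utail; exists k => // n /= kn; exact: (gball_le (leqW kn) kx).
have limit x : exists y, U [set n | f_ n x = y].
  have [k kx] := gball_cover (basept G) x Gconn.
  apply: (ultrafilter_finite_range (A := gball (basept F) k)).
    exact: gball_finite.
  apply: Utail; exists k => // n /= kn.
  exact: red_embedding_ball (leqW kn) (f_emb n) kx.
have [f fP] := choice limit.
(* Two vertices suffice, since no clause of [red_embedding_on] involves more. *)
have common x y : exists n, [/\ gball (basept G) n.+1 x,
    gball (basept G) n.+1 y, f_ n x = f x & f_ n y = f y].
  have [n [[? ?] [? ?]]] := filter_ex (filterI (filterI (Uball x) (Uball y))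
    (filterI (fP x) (fP y))).
  by exists n.
exists f; split.
- have [n [_ _ <- _]] := common (basept G) (basept G).
  by have [] := f_emb n.
- move=> x y _ _; have [n [nx ny <- <-]] := common x y.
  by have [_ + _] := f_emb n; apply.
- move=> x y _ _; have [n [nx ny <- <-]] := common x y.
  by have [_ _] := f_emb n; apply.
Qed.

End RedEmbeddings.

Theorem theorem9 (F G : pointed_graph) (H : graph)
  (F_locfin : locally_finite F) (G_locfin : locally_finite G)
  (G_conn : connected G)
  (arrow_fin : forall G' : pointed_subgraph G,
      connected G' -> finite_graph G' -> arrow_poi F G' H) :
  arrow_poi F G H.
Proof.
move=> c c_sym.
have [blueH|noblue] := EM (exists S : subgraph F,
  monochromatic c blue S /\ isomorphic S H); [by right|left].
suff [f f_emb] : exists f : G -> F, red_embedding_on c [set: G] f.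
  exact: red_embedding_copy f_emb.
apply: red_embedding_limit => // n.
(* The blue alternative is excluded by [noblue]. *)
have [|//] := arrow_fin (ball_pointed_subgraph G n)
  (@ball_subgraph_conn _ _ n) (ball_subgraph_finite (basept G) n G_locfin)
  c c_sym.
by move=> [S [Sred Siso]]; apply: red_copy_embedding Sred Siso.
Qed.
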